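(* Let ${\cal F}=([n],E)$ be a $d$-uniform hypergraph, and let $v$ be a positive integer with $v<d\leq \frac{3v}{2c}$, where $c$ is a constant in $[1,3/2)$. Then the minimum length of an $E$-separable code is at least $$\frac{v}{c(d-v/c)\log\left(\frac{ev}{c(d-v/c)}\right)}\,\log\left(\frac{|E|}{n^{v/c}}\right).$$
   Context: A hypergraph ${\cal F}=([n],E)$ consists of the vertex set $[n]=\{1,\ldots,n\}$ and a family $E$ of subsets of $[n]$ (hyperedges); it is $d$-uniform if every hyperedge has exactly $d$ vertices. For a $t\times n$ binary matrix $M$ with columns $c_1,\ldots,c_n$, $M$ is an $E$-separable code if for any two distinct hyperedges $e,e'\in E$ one has $\bigvee_{j\in e}c_j\neq\bigvee_{j\in e'}c_j$ (bitwise OR of columns); $t$ is its length. Logarithms are base 2, and $e=2.718\ldots$ is the base of the natural logarithm. *)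

(* Defs.v *)
From HB Require Import structures.
From mathcomp Require Import all_boot all_order all_algebra.
From mathcomp Require Import all_classical all_reals all_analysis.

Set Implicit Arguments.
Unset Strict Implicit.
Unset Printing Implicit Defensive.

Import Order.TTheory GRing.Theory Num.Theory.

Local Open Scope ring_scope.

(* A hypergraph on [n] is given by its set of hyperedges, with the vertex set
   {1, ..., n} encoded as 'I_n. *)
Definition uniform_hypergraph (n d : nat) (E : {set {set 'I_n}}) : Prop :=
  forall e : {set 'I_n}, e \in E -> #|e| = d.

Definition or_columns (t n : nat) (M : 'M[bool]_(t, n)) (e : {set 'I_n}) :
    'cV[bool]_t :=
  \col_i \big[orb/false]_(j in e) M i j.

Definition separable_code (n : nat) (E : {set {set 'I_n}}) (t : nat)
    (M : 'M[bool]_(t, n)) : bool :=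
  [forall e in E, forall e' in E, (e != e') ==> 
     (or_columns M e != or_columns M e')].

Lemma separable_codeP (n : nat) (E : {set {set 'I_n}}) (t : nat)
    (M : 'M[bool]_(t, n)) :
  reflect (forall e e' : {set 'I_n}, e \in E -> e' \in E -> e <> e' ->
             or_columns M e <> or_columns M e')
          (separable_code E M).
Proof.
apply: (iffP idP) => [/forall_inP sepM e e' Ee Ee' /eqP nee'|sepM].
  by apply/eqP; move/forall_inP/(_ e' Ee')/implyP: (sepM e Ee); apply.
apply/forall_inP => e Ee; apply/forall_inP => e' Ee'; apply/implyP => /eqP nee'.
by apply/eqP; apply: sepM.
Qed.

(* The identity matrix is a separable code of length n. *)
Lemma ex_separable_code (n : nat) (E : {set {set 'I_n}}) :
  exists t : nat, [exists M : 'M[bool]_(t, n), separable_code E M].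
Proof.
exists n; apply/existsP; exists (\matrix_(i, j) (i == j)).
apply/separable_codeP => e e' _ _ nee' eqe; apply: nee'.
have orE (f : {set 'I_n}) (i : 'I_n) :
    or_columns (\matrix_(i, j) (i == j)) f i ord0 = (i \in f).
  rewrite mxE big_orE; apply/exists_inP/idP => [[j fj]|fi].
    by rewrite mxE => /eqP ->.
  by exists i => //; rewrite mxE.
by apply/setP => i; rewrite -!orE eqe.
Qed.

Definition min_separable_length (n : nat) (E : {set {set 'I_n}}) : nat :=
  ex_minn (ex_separable_code E).

(* As ln x = 0 for x <= 0, log2 0 = 0: this is the value used when E is empty. *)
Definition log2 (R : realType) (x : R) : R := ln x / ln 2.

(* Main.v *)
Require Import Defs.
From HB Require Import structures.
From mathcomp Require Import all_boot all_order all_algebra.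
From mathcomp Require Import all_classical all_reals all_analysis.
From mathcomp Require Import ring lra.

Import Order.TTheory GRing.Theory Num.Theory.
Local Open Scope ring_scope.

(** Write [x = v / c], so that [x < d], and let [t] be the length of a
    separable code. Two elementary counts hold: [|E| <= 2 ^ t], as distinct
    hyperedges have distinct unions, and [|E| <= 'C(n, d) <= n ^ d].
    Interpolating them with weights [(d - x) / d] and [x / d] gives
    [d / (d - x) * log2 (|E| / n ^ x) <= t]. Since [t >= 0], the coefficient may
    be shrunk to [x / ((d - x) * l)] for any [l >= 1], and
    [l = log2 (e x / (d - x))] qualifies because [d <= 3 x / 2] means
    [x / (d - x) >= 2]. *)

Section Log2.
Context {R : realType}.
Implicit Types x y a : R.

Lemma log2_2 : log2 2 = 1 :> R.
Proof. by rewrite /log2 divff // gt_eqF // ln_gt0 // ltr1n. Qed.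

Lemma ler_log2 : {in Num.pos &, {mono @log2 R : x y / x <= y}}.
Proof.
by move=> x y x_gt0 y_gt0; rewrite ler_pM2r ?ler_ln // invr_gt0 ln_gt0 // ltr1n.
Qed.

Lemma log2_div : {in Num.pos &, {morph @log2 R : x y / x / y >-> x - y}}.
Proof. by move=> x y x_gt0 y_gt0; rewrite /log2 ln_div // mulrBl. Qed.

Lemma log2_powR x a : log2 (x `^ a) = a * log2 x.
Proof. by rewrite /log2 ln_powR mulrA. Qed.

Lemma log2_le0 x : x <= 0 -> log2 x = 0.
Proof. by move=> x_le0; rewrite /log2 ln0 // mul0r. Qed.

Lemma log2_ge1 x : 2 <= x -> 1 <= log2 x.
Proof.
by move=> x_ge2; rewrite -log2_2 ler_log2 ?posrE // (lt_le_trans _ x_ge2).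
Qed.

Lemma log2_div_powR_le (m n t d x : R) :
    0 < m -> 0 < n -> 0 <= x -> x <= d -> m <= 2 `^ t -> m <= n `^ d ->
  d * log2 (m / n `^ x) <= (d - x) * t.
Proof.
move=> m_gt0 n_gt0 x_ge0 x_le_d m_le_2t m_le_nd.
have log_m_le_t : log2 m <= t.
  by rewrite -[t]mulr1 -log2_2 -log2_powR ler_log2 ?posrE ?powR_gt0.
have log_m_le_d : log2 m <= d * log2 n.
  by rewrite -log2_powR ler_log2 ?posrE ?powR_gt0.
rewrite log2_div ?posrE ?powR_gt0 // log2_powR.
have -> : d * (log2 m - x * log2 n) =
          (d - x) * log2 m - x * (d * log2 n - log2 m) by ring.
rewrite lerBlDr ler_wpDr ?mulr_ge0 ?subr_ge0 //.
by rewrite ler_wpM2l ?subr_ge0.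
Qed.

End Log2.

Lemma ffact_leq_expn (n m : nat) : (n ^_ m <= n ^ m)%N.
Proof.
by elim: m => // m IHm; rewrite ffactnSr expnSr leq_mul ?leq_subr.
Qed.

Lemma bin_leq_expn (n m : nat) : ('C(n, m) <= n ^ m)%N.
Proof.
apply: leq_trans (ffact_leq_expn n m).
by rewrite -bin_ffact leq_pmulr ?fact_gt0.
Qed.

Lemma card_uniform_hypergraph_le (n d : nat) (E : {set {set 'I_n}}) :
  uniform_hypergraph d E -> (#|E| <= 'C(n, d))%N.
Proof.
move=> Ed; rewrite -[n in leqRHS]card_ord -card_draws.
by apply/subset_leq_card/fintype.subsetP => e /Ed e_d; rewrite inE e_d.
Qed.

Section SeparableCode.
Context {n : nat} (E : {set {set 'I_n}}).

Lemma separable_code_inj (t : nat) (M : 'M[bool]_(t, n)) :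
  separable_code E M -> {in E &, injective (or_columns M)}.
Proof.
move=> /separable_codeP sepM e e' Ee Ee' /eqP; apply: contraTeq => /eqP ne_ee'.
exact/eqP/sepM.
Qed.

Lemma card_separable_code_le (t : nat) (M : 'M[bool]_(t, n)) :
  separable_code E M -> (#|E| <= 2 ^ t)%N.
Proof.
move=> /separable_code_inj /card_in_imset <-; apply: leq_trans (max_card _) _.
by rewrite card_mx card_bool muln1.
Qed.

Lemma min_separable_length_attained :
  exists M : 'M[bool]_(min_separable_length E, n), separable_code E M.
Proof. by rewrite /min_separable_length; case: ex_minnP => t /existsP. Qed.

Lemma log2_card_separable_code_le (R : realType) (d t : nat)
    (M : 'M[bool]_(t, n)) (x : R) :
    uniform_hypergraph d E -> separable_code E M -> 0 <= x -> x <= d%:R ->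
  d%:R * log2 (#|E|%:R / n%:R `^ x) <= (d%:R - x) * t%:R.
Proof.
move=> Ed sepM x_ge0 x_le_d.
have rhs_ge0 : 0 <= (d%:R - x) * t%:R by rewrite mulr_ge0 ?subr_ge0.
have [E0|E_gt0] := posnP #|E|; first by rewrite E0 mul0r log2_le0 ?mulr0.
have card_le_nd : (#|E| <= n ^ d)%N.
  exact: leq_trans (card_uniform_hypergraph_le n d E Ed) (bin_leq_expn n d).
have := leq_trans E_gt0 card_le_nd.
rewrite expn_gt0 => /orP[n_gt0|/eqP d0]; last first.
  by rewrite [X in X%:R * log2 _]d0 mul0r.
apply: log2_div_powR_le; rewrite ?ltr0n // powR_mulrn ?ler0n //.
  by rewrite -natrX ler_nat (card_separable_code_le t M).
by rewrite -natrX ler_nat.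
Qed.

Lemma separable_code_length_ge (R : realType) (d t : nat)
    (M : 'M[bool]_(t, n)) (x l : R) :
    uniform_hypergraph d E -> separable_code E M ->
    0 <= x -> x < d%:R -> 1 <= l ->
  x / ((d%:R - x) * l) * log2 (#|E|%:R / n%:R `^ x) <= t%:R.
Proof.
move=> Ed sepM x_ge0 x_lt_d l_ge1; set L := log2 _.
have d_gt0 : 0 < d%:R :> R by exact: le_lt_trans x_lt_d.
have l_gt0 : 0 < l by exact: lt_le_trans l_ge1.
have a_gt0 : 0 < d%:R - x by rewrite subr_gt0.
have L_le : d%:R * L / (d%:R - x) <= t%:R.
  rewrite ler_pdivrMr // [leRHS]mulrC.
  by apply: log2_card_separable_code_le sepM _ _ => //; exact: ltW.
have weight_ge0 : 0 <= x / (d%:R * l) by rewrite divr_ge0 ?mulr_ge0 // ltW.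
have weight_le1 : x / (d%:R * l) <= 1.
  by rewrite ler_pdivrMr ?mulr_gt0 // mul1r (le_trans (ltW x_lt_d)) // ler_peMr.
have -> : x / ((d%:R - x) * l) * L = x / (d%:R * l) * (d%:R * L / (d%:R - x)).
  by field; rewrite !gt_eqF.
by apply: le_trans (ler_wpM2l weight_ge0 L_le) _; rewrite ler_piMl.
Qed.

End SeparableCode.

Theorem theorem1 (R : realType) (n d v : nat) (c : R) (E : {set {set 'I_n}})
    (Ed : uniform_hypergraph d E) (v_gt0 : (0 < v)%N) (c_ge1 : 1 <= c) (c_lt : c < 3 / 2)
    (v_lt_d : (v < d)%N) (d_le : d%:R <= 3 * v%:R / (2 * c)) :
  v%:R / (c * (d%:R - v%:R / c)
            * log2 (expR 1 * v%:R / (c * (d%:R - v%:R / c))))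
    * log2 (#|E|%:R / n%:R `^ (v%:R / c))
  <= (min_separable_length E)%:R.
Proof.
have [M sepM] := min_separable_length_attained E.
have c_gt0 : 0 < c by exact: lt_le_trans c_ge1.
set l := log2 (expR 1 * _ / _); set x := v%:R / c in l *.
have x_gt0 : 0 < x by rewrite divr_gt0 ?ltr0n.
have x_lt_d : x < d%:R.
  by rewrite (@le_lt_trans _ _ v%:R) ?ltr_nat // ler_pdivrMr // ler_peMr.
have ratio_ge2 : 2 <= x / (d%:R - x).
  rewrite ler_pdivlMr ?subr_gt0 //.
  have : 3 * v%:R / (2 * c) = 3 / 2 * x by rewrite mulf_div.
  lra.
have l_ge1 : 1 <= l.
  have -> : l = log2 (expR 1 * (x / (d%:R - x))).
    by rewrite /l -mulrA invfM [v%:R * _]mulrA.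
  apply/log2_ge1/(le_trans ratio_ge2).
  by rewrite ler_peMl ?(le_trans _ ratio_ge2) // -expR0 ler_expR.
have -> : v%:R / (c * (d%:R - x) * l) = x / ((d%:R - x) * l).
  by rewrite -mulrA invfM mulrA.
by apply: separable_code_length_ge sepM _ _ l_ge1 => //; exact: ltW.
Qed.
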